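(* Let $c\ge1$, let $G$ be a finite nilpotent group of class $t\ge2$, and let $G\cong F/R$ be a free presentation. Then (i)(a) if $c+1\le t$, then $|\gamma_t(G)|\,|M^{(c)}(G)|=|M^{(c)}(G/\gamma_t(G))|\,\left|[R\gamma_t(F),{}_cF]/[R,{}_cF]\right|$; (i)(b) if $c+1>t$, then $|\gamma_{c+1}(G)|\,|M^{(c)}(G)|=|M^{(c)}(G/\gamma_t(G))|\,\left|[R\gamma_t(F),{}_cF]/[R,{}_cF]\right|$; (ii) $\exp(M^{(c)}(G))$ divides $\exp(M^{(c)}(G/\gamma_t(G)))\exp\left([R\gamma_t(F),{}_cF]/[R,{}_cF]\right)$; (iii) $d(M^{(c)}(G))\le d(M^{(c)}(G/\gamma_t(G)))+d\left([R\gamma_t(F),{}_cF]/[R,{}_cF]\right)$.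
   Context: $\gamma_1(X)=X$, $\gamma_{i+1}(X)=[\gamma_i(X),X]$. For subgroups $U,V$, $[U,{}_0V]=U$, $[U,{}_{i+1}V]=[[U,{}_iV],V]$. The $c$-nilpotent multiplier of $G\cong F/R$ ($F$ free) is $M^{(c)}(G)=(R\cap\gamma_{c+1}(F))/[R,{}_cF]$, independent of the presentation. $d(X)$ is the minimal number of generators and $\exp(X)$ the exponent. *)

(* Defs.v *)
(* Abstract (possibly infinite) groups are MathComp's
   [groupType] (mathcomp/boot/monoid.v); subgroups of such groups are
   represented as predicates [F -> Prop]. *)
From HB Require Import structures.
From mathcomp Require Import all_boot all_fingroup all_solvable.
Set Implicit Arguments. Unset Strict Implicit. Unset Printing Implicit Defensive.
Local Open Scope group_scope.

Section AbstractGroups.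
Variable F : groupType.

Definition gset := F -> Prop.
Definition gall : gset := fun _ => True.

Definition is_subgroup (S : gset) : Prop :=
  S 1 /\ (forall x y, S x -> S y -> S (x * y^-1)).

Definition gen (A : gset) : gset :=
  fun x => forall S, is_subgroup S -> (forall a, A a -> S a) -> S x.

Definition commgrp (U V : gset) : gset :=
  gen (fun x => exists u v, U u /\ V v /\ x = [~ u, v]).

(* product subgroup U V (U V = <U ∪ V>; here used for normal subgroups) *)
Definition prodgrp (U V : gset) : gset := gen (fun x => U x \/ V x).

Definition setI (U V : gset) : gset := fun x => U x /\ V x.

Definition itcomm (U V : gset) (i : nat) : gset := iter i (fun W => commgrp W V) U.

Definition gamma (i : nat) : gset := itcomm gall gall i.-1.

(* |A / B| = n  (B a normal subgroup of A): there are exactly n right cosets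
   of B in A, with representatives s 0, ..., s (n-1) *)
Definition qorder (A B : gset) (n : nat) : Prop :=
  exists s : 'I_n -> F, (forall i, A (s i)) /\
    (forall a, A a -> exists! i, B (a * (s i)^-1)).

Definition qexp_prop (A B : gset) (e : nat) : Prop :=
  (0 < e)%N /\ (forall a, A a -> B (a ^+ e)).
Definition qexponent (A B : gset) (e : nat) : Prop :=
  qexp_prop A B e /\ (forall e', qexp_prop A B e' -> (e <= e')%N).

Definition qgenerated_by (A B : gset) (k : nat) : Prop :=
  exists s : 'I_k -> F, (forall i, A (s i)) /\
    (forall a, A a <-> gen (fun x => B x \/ exists i, x = s i) a).

Definition qrank (A B : gset) (d : nat) : Prop :=
  qgenerated_by A B d /\ (forall k, qgenerated_by A B k -> (d <= k)%N).

(* c-nilpotent multiplier of F/R : (R ∩ gamma_{c+1}(F)) / [R, _c F] *)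
Definition Mnum (R : gset) (c : nat) : gset := setI R (gamma c.+1).
Definition Mden (R : gset) (c : nat) : gset := itcomm R gall c.

End AbstractGroups.

Definition is_hom (F H : groupType) (f : F -> H) : Prop :=
  forall x y, f (x * y) = f x * f y.

Definition kernel (F H : groupType) (f : F -> H) : gset F := fun x => f x = 1.

Definition free_on (F : groupType) (X : Type) (e : X -> F) : Prop :=
  forall (H : groupType) (f : X -> H),
    exists g : F -> H, is_hom g /\ (forall x, g (e x) = f x) /\
      (forall g' : F -> H, is_hom g' -> (forall x, g' (e x) = f x) ->
         forall y, g' y = g y).

(* Main.v *)
(* Write R_c = [R,_c F] and Rb = R gamma_t(F), the kernel of F -> G / gamma_t(G).
   Everything takes place between subgroups of F containing R_c:
     R_c <= Q = [Rb,_c F] <= R n gamma_{c+1}(F) <= Rb n gamma_{c+1}(F),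
   where Q <= R because gamma_{t+1}(G) = 1.  The image in G of the largest group is
   gamma_max(t,c+1)(G) and the kernel on it is R n gamma_{c+1}(F), so (i) is Lagrange's
   theorem; (ii) is immediate, and (iii) holds because (Rb n gamma_{c+1}(F)) / Q is abelian,
   by the three subgroups lemma.
   The quotients are finite because gamma_{c+1}(F) / R_c is (Baer's theorem), whether or not
   F is finitely generated or free: the commutator map induces a bilinear surjection by which
   the finiteness of gamma_j(F) / gamma_{j+1}(F) R_{j-1} follows from that of F / R, and
   gamma_{c+t+1}(F) <= R_c since G is nilpotent. *)
Require Import Defs.
From HB Require Import structures.
From mathcomp Require Import all_boot all_fingroup all_solvable.
From mathcomp Require Import boolp.
Local Open Scope group_scope.

(** * Subgroups as predicates: closure rules, commutator subgroups, the lower central series *)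

Section Subgroups.
Set Implicit Arguments.
Unset Strict Implicit.
Variable F : groupType.
Implicit Types (A B C S T N : gset F) (x y : F).

Definition is_normal S := is_subgroup S /\ (forall x y, S x -> S (x ^ y)).

Lemma subgroup1 {S} : is_subgroup S -> S 1.
Proof. by case. Qed.

Lemma subgroupF {S} : is_subgroup S -> forall x y, S x -> S y -> S (x * y^-1).
Proof. by case. Qed.

Lemma subgroupV {S} : is_subgroup S -> forall x, S x -> S x^-1.
Proof. by case=> S1 SF x Sx; rewrite -[_^-1]mul1g; apply: SF. Qed.

Lemma subgroupM {S} : is_subgroup S -> forall x y, S x -> S y -> S (x * y).
Proof.
by move=> sS x y Sx Sy; rewrite -[y]invgK; apply: subgroupF => //; apply: subgroupV.
Qed.

Lemma subgroupX {S} : is_subgroup S -> forall x n, S x -> S (x ^+ n).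
Proof.
move=> sS x n Sx; elim: n => [|n IHn]; first exact: subgroup1.
by rewrite expgS; apply: subgroupM.
Qed.

Lemma subgroup_mulr {S} : is_subgroup S -> forall x y, S y -> S (x * y) -> S x.
Proof. by move=> sS x y Sy Sxy; rewrite -(mulgK y x); apply: subgroupF. Qed.

Lemma coset_sym {S} : is_subgroup S -> forall x y, S (x * y^-1) -> S (y * x^-1).
Proof. by move=> sS x y /(subgroupV sS); rewrite invMg invgK. Qed.

Lemma coset_trans {S} : is_subgroup S ->
  forall x y z, S (x * y^-1) -> S (y * z^-1) -> S (x * z^-1).
Proof. by move=> sS x y z Sxy /(subgroupM sS Sxy); rewrite mulgA mulgVK. Qed.

Lemma normal_conj {S} : is_normal S -> forall x y, S x -> S (x ^ y).
Proof. by case. Qed.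

Lemma normal_mulC {S} : is_normal S -> forall x y, S (x * y) -> S (y * x).
Proof. by move=> nS x y /(normal_conj nS x); rewrite conjgE !mulgA mulVg mul1g. Qed.

Lemma normal_commg {S} : is_normal S -> forall x y, S x -> S [~ x, y].
Proof.
move=> nS x y Sx; rewrite commgEl.
by apply: (subgroupM nS.1); [apply: (subgroupV nS.1) | apply: nS.2].
Qed.

Lemma setI_subgroup A B : is_subgroup A -> is_subgroup B -> is_subgroup (Defs.setI A B).
Proof.
move=> sA sB; split; first by split; apply: subgroup1.
by move=> x y [Ax Bx] [Ay By]; split; apply: subgroupF.
Qed.

Lemma gen_subgroup A : is_subgroup (gen A).
Proof.
split=> [S sS _|x y Ax Ay S sS AS]; first exact: subgroup1.
by apply: subgroupF => //; [apply: Ax | apply: Ay].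
Qed.

Lemma mem_gen A x : A x -> gen A x.
Proof. by move=> Ax S _; apply. Qed.

Lemma gen_sub A S : is_subgroup S -> (forall x, A x -> S x) -> forall x, gen A x -> S x.
Proof. by move=> sS AS x; apply. Qed.

Lemma genS A B : (forall x, A x -> B x) -> forall x, gen A x -> gen B x.
Proof.
by move=> AB; apply: gen_sub => [|x /AB]; [apply: gen_subgroup | apply: mem_gen].
Qed.

Lemma gen_normal A : (forall x y, A x -> gen A (x ^ y)) -> is_normal (gen A).
Proof.
move=> AJ; split=> [|x y]; first exact: gen_subgroup.
move: x; apply: gen_sub => [|x /AJ//]; split=> [|u v Au Av].
  by rewrite conj1g; apply: subgroup1 (gen_subgroup A).
by rewrite conjMg conjVg; apply: (subgroupF (gen_subgroup A)).
Qed.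

Lemma prodgrp_normal A B : is_normal A -> is_normal B -> is_normal (prodgrp A B).
Proof.
move=> nA nB; apply: gen_normal => x y ABx; apply: mem_gen.
by case: ABx => ?; [left | right]; apply: normal_conj.
Qed.

Lemma prodgrp_l A B x : A x -> prodgrp A B x.
Proof. by move=> Ax; apply: mem_gen; left. Qed.

Lemma prodgrp_r A B x : B x -> prodgrp A B x.
Proof. by move=> Bx; apply: mem_gen; right. Qed.

Lemma prodgrp_sub A B S : is_subgroup S -> (forall x, A x -> S x) ->
  (forall x, B x -> S x) -> forall x, prodgrp A B x -> S x.
Proof. by move=> sS AS BS; apply: gen_sub => // x []; [apply: AS | apply: BS]. Qed.

Lemma commgMl x y z : [~ x * y, z] = [~ x, z] ^ y * [~ y, z].
Proof. by rewrite !commgEl !conjgE !invMg !mulgA !mulgK. Qed.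

Lemma commgMr x y z : [~ x, y * z] = [~ x, z] * [~ x, y] ^ z.
Proof. by rewrite !commgEl !conjgE !invMg !mulgA !mulgK. Qed.

Lemma commVg x y : [~ x^-1, y] = [~ x, y]^-1 ^ x^-1.
Proof. by rewrite !commgEl !conjgE !invMg !invgK !mulgA mulgK. Qed.

Lemma commgV x y : [~ x, y^-1] = [~ x, y]^-1 ^ y^-1.
Proof. by rewrite !commgEl !conjgE !invMg !invgK !mulgA mulgV mul1g. Qed.

Lemma hall_witt x y z :
  [~ x, y^-1, z] ^ y * [~ y, z^-1, x] ^ z * [~ z, x^-1, y] ^ x = 1.
Proof.
by rewrite !commgEl !conjgE !invMg !invgK !mulgA !(mulgK, mulgVK, mulgV, mul1g, mulVg).
Qed.

(** Reduces a check that commutators lie in T to generators of the left factor: T, being normal,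
    absorbs the conjugates in [xy,z] = [x,z]^y [y,z]. *)
Lemma commg_left_subgroup T A : is_normal T ->
  is_subgroup (fun x => forall y, A y -> T [~ x, y]).
Proof.
move=> nT; split=> [y _|x y Tx Ty z Az]; first by rewrite comm1g; apply: nT.1.1.
rewrite commgMl commVg; apply: (subgroupM nT.1); apply: normal_conj => //.
  exact: Tx.
by apply: (subgroupV nT.1); apply: Ty.
Qed.

Lemma commg_right_subgroup T A : is_normal T ->
  is_subgroup (fun y => forall x, A x -> T [~ x, y]).
Proof.
move=> nT; split=> [y _|x y Tx Ty z Az]; first by rewrite commg1; apply: nT.1.1.
rewrite commgMr commgV; apply: (subgroupM nT.1); apply: normal_conj => //.
  by apply: (subgroupV nT.1); apply: Ty.
exact: Tx.
Qed.

Lemma mem_commgrp A B x y : A x -> B y -> commgrp A B [~ x, y].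
Proof. by move=> Ax By; apply: mem_gen; exists x, y. Qed.

Lemma commgrp_sub A B S : is_subgroup S -> (forall x y, A x -> B y -> S [~ x, y]) ->
  forall x, commgrp A B x -> S x.
Proof. by move=> sS ABS; apply: gen_sub => // _ [x [y [Ax [By ->]]]]; apply: ABS. Qed.

Lemma commgrp_normal A B : is_normal A -> is_normal B -> is_normal (commgrp A B).
Proof.
move=> nA nB; apply: gen_normal => _ z [x [y [Ax [By ->]]]]; rewrite conjRg.
by apply: mem_commgrp; apply: normal_conj.
Qed.

Lemma commgrpS A B C : (forall x, A x -> B x) ->
  forall x, commgrp A C x -> commgrp B C x.
Proof.
move=> AB; apply: commgrp_sub => [|x y /AB Bx Cy]; first exact: gen_subgroup.
exact: mem_commgrp.
Qed.

Lemma itcomm_normal A i : is_normal A -> is_normal (itcomm A (@gall F) i).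
Proof. by move=> nA; elim: i => //= i IHi; apply: commgrp_normal. Qed.

Lemma itcommS A B i : (forall x, A x -> B x) ->
  forall x, itcomm A (@gall F) i x -> itcomm B (@gall F) i x.
Proof. by move=> AB; elim: i => //= i IHi; apply: commgrpS. Qed.

Lemma itcomm_add A i j : itcomm A (@gall F) (i + j) = itcomm (itcomm A (@gall F) i) (@gall F) j.
Proof. by rewrite addnC; apply: iterD. Qed.

Lemma itcomm_succ A i : itcomm A (@gall F) i.+1 = commgrp (itcomm A (@gall F) i) (@gall F).
Proof. by []. Qed.

Lemma itcomm_succr A i : itcomm A (@gall F) i.+1 = itcomm (commgrp A (@gall F)) (@gall F) i.
Proof. exact: iterSr. Qed.

Lemma itcomm_antitone A i j : is_normal A -> (i <= j)%N ->
  forall x, itcomm A (@gall F) j x -> itcomm A (@gall F) i x.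
Proof.
move=> nA /subnK<-; elim: (j - i)%N => // k IHk x; rewrite addSn itcomm_succ => Ax.
apply: IHk; move: x Ax; apply: commgrp_sub; first by apply: (itcomm_normal _ _).1.
by move=> x y Ax _; apply: normal_commg => //; apply: itcomm_normal.
Qed.

(** Both [gamma 0] and [gamma 1] are F, because of the truncated predecessor, so the recursion
    starts at 1. *)
Lemma gammaS i : (0 < i)%N -> @gamma F i.+1 = commgrp (@gamma F i) (@gall F).
Proof. by case: i. Qed.

Lemma gamma_normal i : is_normal (@gamma F i).
Proof. by apply: itcomm_normal. Qed.

Lemma gamma_antitone i j : (i <= j)%N -> forall x, @gamma F j x -> @gamma F i x.
Proof. by move=> le_ij; apply: itcomm_antitone => //; case: i j le_ij => [|i] []. Qed.

(* Three subgroups lemma in F modulo [N,_(i+1) F]. *)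
Lemma commg_gamma N i : is_normal N ->
  forall x y, N x -> @gamma F i.+1 y -> itcomm N (@gall F) i.+1 [~ x, y].
Proof.
(* N stays general: the induction hypothesis is needed for N and for [N,F]. *)
move=> + x y; elim: i N x y => [|i IHi] N x y nN Nx.
  by move=> _; apply: mem_commgrp.
set T := itcomm _ _ _; have nT : is_normal T by apply: itcomm_normal.
rewrite gammaS // => Gy; move: y Gy x Nx; apply: commgrp_sub.
  exact: commg_right_subgroup.
move=> u v Gu _ x Nx; rewrite -invgR; apply: (subgroupV nT.1).
(* In the Hall-Witt identity for u, v^-1, x two factors lie in T: this one by the induction
   hypothesis for [N,F], [Txuv] by the one for N. *)
have Tvxu : T [~ v^-1, x^-1, u].
  rewrite /T itcomm_succr; apply: IHi => //; first exact: commgrp_normal.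
  rewrite -invgR; apply: (subgroupV (gen_subgroup _)).
  by apply: mem_commgrp => //; apply: (subgroupV nN.1).
have Txuv : T [~ x, u^-1, v^-1].
  apply: mem_commgrp => //; apply: IHi => //.
  exact: (subgroupV (gamma_normal _).1).
rewrite -[commg _ _](conjgK v^-1); apply: (normal_conj nT).
have := hall_witt u v^-1 x; rewrite invgK -mulgA => E.
apply: (subgroup_mulr nT.1 (y := [~ v^-1, x^-1, u] ^ x * [~ x, u^-1, v^-1] ^ u)).
  by apply: (subgroupM nT.1); apply: (normal_conj nT).
by rewrite E; apply: nT.1.1.
Qed.
End Subgroups.

(** * Finiteness of quotients in an arbitrary group *)

Section FiniteIndex.
Set Implicit Arguments.
Unset Strict Implicit.
Variable F : groupType.
Implicit Types (A B C D H M N R S T : gset F) (x y g : F).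

Lemma prodgrpP A B x : is_normal A -> is_normal B ->
  prodgrp A B x -> exists2 a, A a & exists2 b, B b & x = a * b.
Proof.
move=> nA nB; move: x; apply: prodgrp_sub.
- split; first by exists 1; [exact: nA.1.1 | exists 1; [exact: nB.1.1 | rewrite mulg1]].
  move=> _ _ [a Aa [b Bb ->]] [a' Aa' [b' Bb' ->]].
  exists (a * a'^-1); first exact: (subgroupF nA.1).
  exists ((b * b'^-1) ^ a'^-1); first by apply: (normal_conj nB); apply: (subgroupF nB.1).
  by rewrite conjgE invMg invgK !mulgA mulgVK.
- by move=> x Ax; exists x => //; exists 1; [exact: nB.1.1 | rewrite mulg1].
- by move=> x Bx; exists 1; [exact: nA.1.1 | exists x; rewrite ?mul1g].
Qed.

(* Neither containment nor closure is assumed: finitely many translates of B cover A. *)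
Definition fin_index A B :=
  exists l : seq F, forall a, A a -> exists2 x, x \in l & B (a * x^-1).

Lemma fin_indexS A A' B B' : (forall x, A' x -> A x) -> (forall x, B x -> B' x) ->
  fin_index A B -> fin_index A' B'.
Proof. by move=> sA sB [l cov]; exists l => a /sA/cov[x lx /sB]; exists x. Qed.

Lemma fin_index_trans A B C : fin_index A B -> fin_index B C -> fin_index A C.
Proof.
move=> [lA covA] [lB covB]; exists [seq y * x | x <- lA, y <- lB] => a /covA[x lx].
move=> /covB[y ly Cy]; exists (y * x); first exact: allpairs_f.
by rewrite invMg mulgA.
Qed.

Lemma fin_index_prodgrp A B C D : is_normal A -> is_normal D -> is_normal C ->
  (forall x, B x -> C x) -> (forall x, D x -> C x) ->
  fin_index A B -> fin_index (prodgrp A D) C.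
Proof.
move=> nA nD nC sBC sDC [l cov]; exists l => x /(prodgrpP nA nD)[a /cov[y ly By] [d Dd ->]].
exists y => //; have -> : a * d * y^-1 = a * y^-1 * d ^ y^-1.
  by rewrite conjgE invgK !mulgA mulgVK.
by apply: (subgroupM nC.1); [apply: sBC | apply: (normal_conj nC); apply: sDC].
Qed.

(** As powers of g normalise N, the group <N,g> is the union of the cosets N g^k, and g^n in N
    reduces k modulo n. *)
Lemma gen_adjoin_torsion N g n : is_subgroup N -> (0 < n)%N -> N (g ^+ n) ->
    (forall x k, N x -> N (x ^ g ^- k)) ->
  forall x, gen (fun y => N y \/ y = g) x -> exists2 k, (k < n)%N & N (x * g ^- k).
Proof.
move=> sN n_gt0 Ngn Ng x gx.
have Ngm m : N (g ^+ (n * m)) by rewrite expgnA; apply: subgroupX.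
suff [k Nk] : exists k, N (x * g ^- k).
  exists (k %% n)%N; first by rewrite ltn_mod.
  rewrite {1}(divn_eq k n) mulnC expgnDr invMg mulgA in Nk.
  exact: (subgroup_mulr sN (subgroupV sN (Ngm (k %/ n)%N)) Nk).
move: x gx; apply: gen_sub; last first.
  by move=> x [Nx | ->]; [exists 0%N; rewrite invg1 mulg1 | exists 1%N; rewrite mulgV; case: sN].
split=> [|x y [k Nx] [l Ny]]; first by exists 0%N; rewrite mul1g invg1; case: sN.
(* This exponent replaces k - l, to which it is congruent modulo n, so that exponents stay natural
   numbers. *)
exists (k + n.-1 * l)%N; set m := (k + _)%N.
have -> : x * y^-1 * g ^- m =
   (x * g ^- k) * (g ^- (n * l) * (y * g ^- l)^-1) ^ g ^- m.
  have -> : g ^+ k = g ^+ m * g ^- (n.-1 * l).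
    by rewrite -expgnFr ?leq_addl // /m addnK.
  have -> : (n * l = l + n.-1 * l)%N by rewrite -{1}(prednK n_gt0) mulSn.
  by rewrite conjgE [g ^+ (l + _)]expgnDr !invMg !invgK !mulgA !(mulgK, mulgVK).
by apply: (subgroupM sN) => //; apply: Ng; apply: (subgroupM sN); apply: (subgroupV sN).
Qed.

(** The elements of l are adjoined one at a time; each is central modulo T with n-th power in T, so
    the enlarged group is again normal and n translates suffice at each step. *)
Lemma fin_index_central T n (l : seq F) : is_normal T -> (0 < n)%N ->
    (forall x, x \in l -> T (x ^+ n) /\ (forall y, T [~ x, y])) ->
  fin_index (gen (fun x => T x \/ x \in l)) T.
Proof.
move=> + n_gt0; elim: l T => [|g l IHl] T nT Tl.
  exists [:: 1] => x Tx; exists 1; first exact: mem_head.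
  rewrite invg1 mulg1; move: x Tx; apply: gen_sub; first exact: nT.1.
  by move=> x [].
have [Tgn Tg] := Tl g (mem_head _ _); set T' := gen (fun x => T x \/ x = g).
have TT' x : T x -> T' x by move=> Tx; apply: mem_gen; left.
have nT' : is_normal T'.
  apply: gen_normal => x y [Tx | ->]; first by apply: TT'; apply: (normal_conj nT).
  rewrite -(mulKVg g (g ^ y)) -commgEl; apply: (subgroupM (gen_subgroup _)).
    by apply: mem_gen; right.
  exact: TT'.
apply: (@fin_index_trans _ T'); last first.
  exists [seq g ^+ k | k <- iota 0 n] => x T'x.
  have Tgk y k : T y -> T (y ^ g ^- k) by apply: (normal_conj nT).
  have [k lt_kn Tk] := gen_adjoin_torsion nT.1 n_gt0 Tgn Tgk T'x.
  by exists (g ^+ k) => //; apply: map_f; rewrite mem_iota.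
apply: fin_indexS (IHl T' nT' _) => //; last first.
  by move=> x lx; have [|Txn Tx] := Tl x; [rewrite in_cons lx orbT | split=> *; apply: TT'].
apply: genS => x [Tx|]; first by left; apply: TT'.
rewrite in_cons => /predU1P[->|]; last by right.
by left; apply: mem_gen; right.
Qed.

(** Since [x,y] is central modulo T, [x, y y^n] = [x,y^n] [x,y]^(y^n) is congruent to [x,y^n]
    [x,y]. *)
Lemma commgX_mod T x y n : is_normal T -> (forall z, T [~ x, y, z]) ->
  T ([~ x, y ^+ n] * [~ x, y] ^- n).
Proof.
move=> nT Txy; elim: n => [|n IHn]; first by rewrite commg1 invg1 mulg1; case: nT.1.
set c := [~ x, y] in Txy IHn *.
have E p d w : p * c ^ w * (d * c)^-1 = p * d^-1 * ([~ c, w] ^ c^-1) ^ d^-1.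
  by rewrite commgEl !conjgE !invMg !invgK !mulgA !(mulgK, mulgVK).
rewrite expgS commgMr -/c expgSr E.
by apply: (subgroupM nT.1) => //; do 2!apply: (normal_conj nT).
Qed.

(* Modulo T the commutator map H x F -> [H,F] is bilinear and factors through
   the finite sets H/M and F/R. *)
Lemma fin_index_commgrp H M R T n : is_subgroup H -> is_normal T ->
    (forall x, M x -> H x) -> (forall x y, M x -> T [~ x, y]) ->
    (forall x y, H x -> R y -> T [~ x, y]) ->
    (forall x y z, H x -> T [~ x, y, z]) ->
    (0 < n)%N -> (forall x, R (x ^+ n)) ->
    fin_index H M -> fin_index (@gall F) R ->
  fin_index (commgrp H (@gall F)) T.
Proof.
move=> sH nT sMH TM THR THF n_gt0 Rn [lH covH] [lR covR].
(* The cover of H may list elements outside H, which are filtered out; an entry that serves some h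
   in H is itself in H because M <= H. *)
pose l := [seq [~ x, y] | x <- [seq x <- lH | `[< H x >]], y <- lR].
apply: fin_indexS (@fin_index_central T n l nT n_gt0 _) => //; last first.
  move=> _ /allpairsP[[x y] /= [+ _ ->]]; rewrite mem_filter => /andP[/asboolP Hx _].
  split=> [|z]; last exact: THF.
  (* Modulo T, [x,y]^n is [x,y^n], and y^n lies in R. *)
  rewrite -[_ ^+ n]invgK; apply: (subgroupV nT.1).
  have := commgX_mod (y := y) n nT (fun z => THF x y z Hx).
  move=> /(normal_mulC nT); apply: subgroup_mulr => //; first exact: nT.1.
  exact: THR.
apply: commgrp_sub => [|h k Hh _]; first exact: gen_subgroup.
have [x lx Mx] := covH h Hh; have [y ly Ry] := covR k I.
have Hx : H x.
  rewrite -[x](mulKg (h * x^-1)) mulgVK.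
  by apply: (subgroupM sH) => //; apply: (subgroupV sH); apply: sMH.
(* Only the factor [x,y] survives modulo T. *)
have -> : [~ h, k] = [~ h * x^-1, k] ^ x * ([~ x, y] * [~ x, k * y^-1] ^ y).
  by rewrite -commgMr mulgVK -commgMl mulgVK.
have sG := gen_subgroup (fun z => T z \/ z \in l).
apply: (subgroupM sG); first by apply: mem_gen; left; apply: (normal_conj nT); apply: TM.
apply: (subgroupM sG); apply: mem_gen; last by left; apply: (normal_conj nT); apply: THR.
by right; apply: allpairs_f => //; rewrite mem_filter lx andbT; apply/asboolP.
Qed.

(** * Baer's theorem: finiteness of gamma_{c+1}(F) / [R,_c F] *)

Variables (R : gset F) (n : nat).
Hypotheses (nR : is_normal R) (n_gt0 : (0 < n)%N) (Rn : forall x, R (x ^+ n)).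
Hypothesis finR : fin_index (@gall F) R.

(** Induction with H = gamma_{j+1}(F), M = gamma_{j+2}(F) [R,_j F] and T = gamma_{j+3}(F)
    [R,_{j+1} F]; the three subgroups lemma gives [gamma_{j+1}(F), R] <= T. *)
Lemma fin_index_gamma_succ j :
  fin_index (@gamma F j.+1) (prodgrp (@gamma F j.+2) (itcomm R (@gall F) j)).
Proof.
elim: j => [|j IHj]; first by apply: fin_indexS finR => // x; apply: prodgrp_r.
have nT : is_normal (prodgrp (@gamma F j.+3) (itcomm R (@gall F) j.+1)).
  by apply: prodgrp_normal; [apply: gamma_normal | apply: itcomm_normal].
rewrite gammaS //; apply: (fin_index_commgrp _ nT _ _ _ _ n_gt0 Rn IHj finR).
- exact: (gamma_normal _ _).1.
- apply: prodgrp_sub; first exact: (gamma_normal _ _).1.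
    exact: gamma_antitone.
  exact: itcommS.
- move=> x y Mx; apply: (prodgrp_sub (commg_left_subgroup (@gall F) nT) _ _ Mx) => // u Gu z _.
    by apply: prodgrp_l; apply: mem_commgrp.
  by apply: prodgrp_r; apply: mem_commgrp.
- move=> x y Gx Ry; apply: prodgrp_r; rewrite -invgR.
  by apply: (subgroupV (gen_subgroup _)); apply: commg_gamma.
- by move=> x y z Gx; apply: prodgrp_l; do 2!apply: mem_commgrp => //.
Qed.

(** With D = [R,_c F], each gamma_{c+k+1}(F) D is finite over gamma_{c+k+2}(F) D, because
    [R,_{c+k} F] <= D. At k = t the chain has reached D, since gamma_{c+t+1}(F) =
    [gamma_{t+1}(F),_c F]. *)
Lemma fin_index_gamma c t : (forall x, @gamma F t.+1 x -> R x) ->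
  fin_index (@gamma F c.+1) (itcomm R (@gall F) c).
Proof.
move=> sGR; have nD i : is_normal (itcomm R (@gall F) i) by apply: itcomm_normal.
have chain k : fin_index (@gamma F c.+1) (prodgrp (@gamma F (c + k).+1) (itcomm R (@gall F) c)).
  elim: k => [|k IHk].
    exists [:: 1] => x Gx; exists 1; first exact: mem_head.
    by rewrite invg1 mulg1 addn0; apply: prodgrp_l.
  apply: fin_index_trans IHk _; rewrite addnS.
  apply: fin_index_prodgrp (fin_index_gamma_succ (c + k)) => //.
  - exact: gamma_normal.
  - by apply: prodgrp_normal => //; apply: gamma_normal.
  - apply: prodgrp_sub; first by apply: gen_subgroup.
      exact: prodgrp_l.
    by move=> x Dx; apply: prodgrp_r; apply: itcomm_antitone Dx => //; apply: leq_addr.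
  - exact: prodgrp_r.
apply: fin_indexS (chain t) => //; apply: prodgrp_sub => //; first exact: (nD c).1.
by rewrite /gamma /= addnC itcomm_add; apply: itcommS.
Qed.

End FiniteIndex.

(** * Order, exponent and rank of a quotient A / B *)

Section Invariants.
Set Implicit Arguments.
Unset Strict Implicit.
Variable F : groupType.
Implicit Types (A B C : gset F) (x y g : F) (l : seq F).

(** Excluded middle makes an arbitrary P boolean; this supplies the minima that define exponent and
    rank. *)
Lemma ex_min_nat (P : nat -> Prop) : (exists n, P n) ->
  exists2 n, P n & forall m, P m -> (n <= m)%N.
Proof.
move=> exP; have exb : exists n, `[< P n >] by case: exP => n /asboolP; exists n.
case: (ex_minnP exb) => n /asboolP Pn min_n; exists n => // m /asboolP.
exact: min_n.
Qed.

Lemma qorder_card (I : finType) A B (s : I -> F) : (forall i, A (s i)) ->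
  (forall a, A a -> exists! i, B (a * (s i)^-1)) -> qorder A B #|I|.
Proof.
move=> As covs; exists (fun k => s (enum_val k)); split=> // a /covs[i [Bi uniq_i]].
exists (enum_rank i); split=> [|k /uniq_i ->]; first by rewrite enum_rankK.
exact: enum_valK.
Qed.

(** The cover is thinned out to representatives in A that are pairwise incongruent modulo B. *)
Lemma fin_index_qorder A B : is_subgroup B -> fin_index A B -> exists n, qorder A B n.
Proof.
move=> sB [l cov]; pose r x y := ~~ `[< B (x * y^-1) >].
have [l' [Al' rl' covl']] : exists l', [/\ forall x, x \in l' -> A x, pairwise r l' &
    forall a, A a -> (exists2 x, x \in l & B (a * x^-1)) ->
      exists2 x, x \in l' & B (a * x^-1)].
  elim: l {cov} => [|x l [l' [Al' rl' covl']]]; first by exists [::]; split=> // a _ [].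
  (* The entry x matters only if its coset holds an element a of A not yet covered, and then a takes
     its place. *)
  have [[a Aa [Bax nBa]]|none] := pselect (exists2 a, A a &
      B (a * x^-1) /\ forall y, y \in l' -> ~ B (a * y^-1)).
    exists (a :: l'); split=> [y|/=|b Ab [y]].
    - by rewrite in_cons => /predU1P[->|/Al'].
    - by rewrite rl' andbT; apply/allP => y /nBa nBay; apply/asboolPn.
    - rewrite in_cons => /predU1P[-> Bbx | ly Bby].
        exists a; first exact: mem_head.
        by apply: (coset_trans sB Bbx); apply: (coset_sym sB).
      have [|z l'z Bbz] := covl' b Ab; first by exists y.
      by exists z; rewrite // in_cons l'z orbT.
  exists l'; split=> // a Aa [y]; rewrite in_cons => /predU1P[-> Bax | ly Bay].
    apply: contrapT => no; apply: none; exists a => //; split=> // z lz Bz.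
    by apply: no; exists z.
  by apply: covl' => //; exists y.
exists (size l'), (fun i => nth 1 l' i); split=> [i|a Aa]; first by apply: Al'; rewrite mem_nth.
have [_ /(nthP 1)[i lt_i <-] Bi] := covl' a Aa (cov a Aa).
exists (Ordinal lt_i); split=> //= j Bj; apply: val_inj => /=.
have Bxy x y : B (a * x^-1) -> B (a * y^-1) -> B (x * y^-1).
  by move=> /(coset_sym sB); apply: coset_trans.
have nB k m : (k < m)%N -> (m < size l')%N -> ~ B (nth 1 l' k * (nth 1 l' m)^-1).
  by move=> lt_km lt_m; apply/asboolPn/(pairwiseP 1 rl'); rewrite ?inE // (ltn_trans lt_km).
by case: (ltngtP i j) => // lt_ij; case: (nB _ _ lt_ij _) => //; apply: Bxy.
Qed.

(** Lagrange's theorem: the products t_j s_i, in this order for right cosets, represent A modulo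
    C. *)
Lemma qorderM A B C a b : is_subgroup A -> is_subgroup B -> is_subgroup C ->
    (forall x, B x -> A x) -> (forall x, C x -> B x) ->
  qorder A B a -> qorder B C b -> qorder A C (a * b).
Proof.
move=> sA sB sC sBA sCB [s [As covs]] [t [Bt covt]].
rewrite -[a]card_ord -[b]card_ord -card_prod.
apply: (@qorder_card _ A C (fun ij => t ij.2 * s ij.1)) => [ij|x Ax].
  by apply: (subgroupM sA) => //; apply: sBA.
have [i [Bi uniq_i]] := covs x Ax; have [j [Cj uniq_j]] := covt _ Bi.
exists (i, j); split=> [|[i' j']] /=; first by rewrite invMg mulgA.
rewrite invMg mulgA => Ct.
have Bi' : B (x * (s i')^-1).
  by apply: (subgroup_mulr sB (y := (t j')^-1)); [apply: (subgroupV sB) | apply: sCB].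
by have E := uniq_i _ Bi'; rewrite -E in Ct; rewrite E (uniq_j _ Ct).
Qed.

Lemma qorder_leq A B a b : is_subgroup B -> qorder A B a -> qorder A B b -> (a <= b)%N.
Proof.
move=> sB [s [As covs]] [t [At covt]].
have /choice[f fP] : forall i, exists j, B (s i * (t j)^-1).
  by move=> i; have [j [Bj _]] := covt _ (As i); exists j.
rewrite -[a]card_ord -[b]card_ord; apply: (@leq_card _ _ f) => i j Eij.
have [k [_ uniq_k]] := covs _ (As i).
have <- : k = i by apply: uniq_k; rewrite mulgV; apply: subgroup1.
apply: uniq_k; apply: (coset_trans sB (fP i)); rewrite Eij.
exact: (coset_sym sB).
Qed.

Lemma qorder_uniq A B a b : is_subgroup B -> qorder A B a -> qorder A B b -> a = b.
Proof. by move=> sB oa ob; apply/eqP; rewrite eqn_leq !(qorder_leq sB (A := A)). Qed.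

(** By pigeonhole two of the powers a^0, ..., a^n share a coset, so a^(j-i) is in B for some 0 < j -
    i <= n; every such difference divides n!. *)
Lemma qorder_exp A B n : is_subgroup A -> is_subgroup B -> qorder A B n ->
  forall a, A a -> B (a ^+ n`!).
Proof.
move=> sA sB [s [As covs]] a Aa.
have /choice[f fP] : forall k : 'I_n.+1, exists j, B (a ^+ k * (s j)^-1).
  by move=> k; have [|j [Bj _]] := covs (a ^+ k); [apply: subgroupX | exists j].
have [i [j lt_ij Eij]] : exists i : 'I_n.+1, exists2 j : 'I_n.+1, (i < j)%N & f i = f j.
  have /injectivePn[i [j ne_ij Eij]] : ~~ injectiveb f.
    by apply/injectiveP => /leq_card; rewrite !card_ord ltnn.
  case: (ltngtP i j) => [||/val_inj E]; [by exists i, j | by exists j, i |].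
  by rewrite E eqxx in ne_ij.
have Bij : B (a ^+ (j - i)).
  rewrite expgnFr 1?ltnW // //; apply: (coset_trans sB (fP j)); rewrite -Eij.
  exact: (coset_sym sB).
have /dvdnP[q ->] : (j - i %| n`!)%N.
  by apply: dvdn_fact; rewrite subn_gt0 lt_ij (leq_trans (leq_subr _ _)) // -ltnS.
by rewrite mulnC expgnA; apply: subgroupX.
Qed.

Lemma qexponent_exists A B : (exists2 n, (0 < n)%N & forall a, A a -> B (a ^+ n)) ->
  exists e, qexponent A B e.
Proof.
move=> [n n_gt0 Bn]; have [|e Pe min_e] := @ex_min_nat (qexp_prop A B); last by exists e.
by exists n.
Qed.

(** The exponent is defined as a least number; a nonzero remainder of n modulo e would be a smaller
    one. *)
Lemma qexponent_dvd A B e n : is_subgroup B -> qexponent A B e ->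
  (forall a, A a -> B (a ^+ n)) -> (e %| n)%N.
Proof.
move=> sB [[e_gt0 Be] min_e] Bn; rewrite /dvdn -leqn0 leqNgt; apply/negP => r_gt0.
suff /min_e : qexp_prop A B (n %% e) by rewrite leqNgt ltn_mod e_gt0.
split=> // a Aa; have := Bn a Aa; rewrite {1}(divn_eq n e) mulnC addnC expgnDr expgnA.
by apply: subgroup_mulr => //; apply: subgroupX => //; apply: Be.
Qed.

(** Lists replace indexed families, for concatenation and for induction on the generators. *)
Lemma qgenerated_byP A B k : qgenerated_by A B k <->
  exists2 l, size l = k & forall x, A x <-> gen (fun y => B y \/ y \in l) x.
Proof.
split=> [[s [As genA]] | [l <- genA]].
  exists (codom s); first by rewrite size_codom card_ord.
  move=> x; rewrite genA; split; apply: genS => y [By|]; by [left|right; apply/codomP|].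
exists (fun i => nth 1 l i); split=> [i|x].
  by apply/genA; apply: mem_gen; right; apply: mem_nth.
rewrite genA; split; apply: genS => y [By|].
- by left.
- by move=> /(nthP 1)[i lt_i <-]; right; exists (Ordinal lt_i).
- by left.
- by move=> [i ->]; right; apply: mem_nth.
Qed.

Lemma qrank_exists A B : is_subgroup A -> is_subgroup B -> (forall x, B x -> A x) ->
  fin_index A B -> exists d, qrank A B d.
Proof.
move=> sA sB sBA [l cov].
have [|d gd min_d] := @ex_min_nat (qgenerated_by A B); last by exists d.
exists (size [seq x <- l | `[< A x >]]); apply/qgenerated_byP.
exists [seq x <- l | `[< A x >]] => // a; split=> [Aa|].
  have [x lx Bx] := cov a Aa; rewrite -(mulgVK x a).
  apply: (subgroupM (gen_subgroup _)); apply: mem_gen; first by left.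
  right; rewrite mem_filter lx andbT; apply/asboolP.
  rewrite -[x](mulKg (a * x^-1)) mulgVK.
  by apply: (subgroupM sA) => //; apply: (subgroupV sA); apply: sBA.
by apply: gen_sub => // x [/sBA//|]; rewrite mem_filter => /andP[/asboolP].
Qed.

Lemma qgenerated_by_trans A B C a b : is_subgroup A ->
    (forall x, B x -> A x) -> (forall x, C x -> B x) ->
  qgenerated_by A B a -> qgenerated_by B C b -> qgenerated_by A C (a + b).
Proof.
move=> sA sBA sCB /qgenerated_byP[l <- genA] /qgenerated_byP[l' <- genB].
apply/qgenerated_byP; exists (l ++ l') => [|x]; first exact: size_cat.
split=> [/genA|].
  apply: gen_sub; [exact: gen_subgroup | move=> y [/genB|ly]].
    by apply: genS => z [Cz|lz]; [left | right; rewrite mem_cat lz orbT].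
  by apply: mem_gen; right; rewrite mem_cat ly.
apply: gen_sub => // y [Cy|]; first by apply: sBA; apply: sCB.
rewrite mem_cat => /orP[ly|ly]; first by apply/genA; apply: mem_gen; right.
by apply: sBA; apply/genB; apply: mem_gen; right.
Qed.

(* The classical argument for subgroups of Z^d; torsion makes the ideal of
   exponents at each step nonzero. *)
Lemma qgenerated_by_subgroup A B C n d : is_subgroup A -> is_subgroup B -> is_subgroup C ->
    (forall x, B x -> C x) -> (forall x, C x -> A x) ->
    (forall x y, A x -> A y -> B [~ x, y]) ->
    (0 < n)%N -> (forall a, A a -> B (a ^+ n)) ->
  qgenerated_by A B d -> qgenerated_by C B d.
Proof.
move=> sA sB sC sBC sCA abelA n_gt0 Bn /qgenerated_byP[l <- genA].
pose G l := gen (fun y => B y \/ y \in l).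
(* For the induction, A = <B,l> is weakened to l in A and C <= <B,l>, a form that can be
   re-established for a shorter list. *)
have {genA}[Al sCl] : (forall x, x \in l -> A x) /\ (forall x, C x -> G l x).
  by split=> [x lx | x /sCA/genA//]; apply/genA; apply: mem_gen; right.
suff [l' sz_l' genC] : exists2 l', size l' = size l & forall x, C x <-> G l' x.
  by apply/qgenerated_byP; exists l'.
elim: l Al C sC sBC sCA sCl => [|g l IHl] Al C sC sBC sCA sCl.
  exists [::] => // x; split=> [/sCl//|].
  by apply: gen_sub => // y [/sBC|].
have Ag : A g by apply: Al; apply: mem_head.
have {}Al x : x \in l -> A x by move=> lx; apply: Al; rewrite in_cons lx orbT.
pose N := G l; have sN : is_subgroup N by apply: gen_subgroup.
have sBN x : B x -> N x by move=> Bx; apply: mem_gen; left.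
have sNA x : N x -> A x by apply: gen_sub => // y [/sBC/sCA|/Al].
have Ng x k : N x -> N (x ^ g ^- k).
  move=> Nx; rewrite -(mulKVg x (x ^ _)) -commgEl; apply: (subgroupM sN) => //.
  by apply: sBN; apply: abelA; [apply: sNA | apply: (subgroupV sA); apply: subgroupX].
have NX x k q : N (x * g ^- k) -> N (x ^+ q * g ^- (k * q)).
  move=> Nx; elim: q => [|q IHq]; first by rewrite muln0 invg1 mulg1; apply: subgroup1.
  have -> : x ^+ q.+1 * g ^- (k * q.+1) =
      x ^+ q * g ^- (k * q) * (x * g ^- k) ^ g ^- (k * q).
    by rewrite mulnSr expgnDr expgSr conjgE !invMg invgK !mulgA mulgVK.
  by apply: (subgroupM sN) => //; apply: Ng.
(* These are the positive exponents of g occurring in C modulo N; n is one, since g^n is in B, and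
   the least one, k0, comes from c. *)
pose P k := (0 < k)%N /\ exists2 x, C x & N (x * g ^- k).
have [|k0 [k0_gt0 [c Cc Nc]] min_k0] := @ex_min_nat P.
  exists n; split=> //; exists 1; first exact: subgroup1.
  by rewrite mul1g; apply: (subgroupV sN); apply: sBN; apply: Bn.
(* The generators of C n N together with c will generate C. *)
have [||||l' sz_l' genCN] := IHl Al (Defs.setI C N).
- exact: setI_subgroup.
- by move=> x Bx; split; [apply: sBC | apply: sBN].
- by move=> x [/sCA].
- by move=> x [].
exists (c :: l') => [|x]; first by rewrite /= sz_l'.
split=> [Cx|]; last first.
  apply: gen_sub => // y [/sBC//|]; rewrite in_cons => /predU1P[->//|l'y].
  by have [] : Defs.setI C N y by apply/genCN; apply: mem_gen; right.
have [|k _ Nk] := gen_adjoin_torsion (x := x) sN n_gt0 (sBN _ (Bn _ Ag)) Ng.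
  apply: genS (sCl x Cx) => y [By|]; first by left; apply: sBN.
  by rewrite in_cons => /predU1P[->|ly]; [right | left; apply: mem_gen; right].
(* Dividing by k0 leaves x c^-q with exponent r < k0, so r = 0 by minimality and x c^-q is in C n
   N. *)
set q := (k %/ k0)%N; set r := (k %% k0)%N.
have Nr : N (x * c ^- q * g ^- r).
  have -> : x * c ^- q * g ^- r = x * g ^- k * (c ^+ q * g ^- (k0 * q))^-1 ^ g ^- r.
    rewrite (divn_eq k k0) -/q -/r [(q * k0)%N]mulnC addnC expgnDr.
    by rewrite conjgE !invMg !invgK !mulgA !mulgVK.
  by apply: (subgroupM sN) => //; apply: Ng; apply: (subgroupV sN); apply: NX.
have r0 : r = 0%N.
  apply/eqP; rewrite -leqn0 leqNgt; apply/negP => r_gt0.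
  suff /min_k0 : P r by rewrite leqNgt ltn_mod k0_gt0.
  split=> //; exists (x * c ^- q) => //.
  by apply: (subgroupM sC) => //; apply: (subgroupV sC); apply: subgroupX.
rewrite r0 invg1 mulg1 in Nr; rewrite -(mulgVK (c ^+ q) x).
apply: (subgroupM (gen_subgroup _)); last first.
  apply: (subgroupX (gen_subgroup _)); apply: mem_gen; right; exact: mem_head.
have /genCN : Defs.setI C N (x * c ^- q).
  by split=> //; apply: (subgroupM sC) => //; apply: (subgroupV sC); apply: subgroupX.
by apply: genS => y [By|l'y]; [left | right; rewrite in_cons l'y orbT].
Qed.
End Invariants.

(** * Homomorphisms to a finite group and its lower central series *)

Section Homomorphisms.
Set Implicit Arguments.
Unset Strict Implicit.
Variables (F : groupType) (gT : finGroupType) (pi : F -> gT).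
Hypothesis hom_pi : is_hom pi.

Lemma hom1 : pi 1 = 1.
Proof. by apply: (mulgI (pi 1)); rewrite -hom_pi !mulg1. Qed.

Lemma homV x : pi x^-1 = (pi x)^-1.
Proof. by apply: (mulgI (pi x)); rewrite -hom_pi !mulgV hom1. Qed.

Lemma homX x n : pi (x ^+ n) = pi x ^+ n.
Proof. by elim: n => [|n IHn]; rewrite ?hom1 // !expgS hom_pi IHn. Qed.

Lemma homJ x y : pi (x ^ y) = pi x ^ pi y.
Proof. by rewrite !conjgE !hom_pi homV. Qed.

Lemma homR x y : pi [~ x, y] = [~ pi x, pi y].
Proof. by rewrite !commgEl hom_pi homV homJ. Qed.

Lemma preim_subgroup (S : {group gT}) : is_subgroup (fun x => pi x \in S).
Proof. by split=> [|x y Sx Sy]; rewrite ?hom1 // hom_pi homV groupM ?groupV. Qed.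

Lemma kernel_normal : is_normal (kernel pi).
Proof.
split=> [|x y]; last by rewrite /kernel homJ => ->; rewrite conj1g.
by split=> [|x y]; rewrite /kernel ?hom1 // hom_pi homV => -> ->; rewrite mulgV.
Qed.

Lemma kernel_fin_index : fin_index (@gall F) (kernel pi).
Proof.
have /choice[s sP] : forall g, exists x, (exists y, pi y = g) -> pi x = g.
  (* Elements of [gT] outside the image get the default 1. *)
  by move=> g; have [[y <-]|no] := pselect (exists y, pi y = g); [exists y | exists 1].
exists [seq s g | g <- enum gT] => a _; exists (s (pi a)).
  by apply: map_f; rewrite mem_enum.
by rewrite /kernel hom_pi homV sP ?mulgV //; exists a.
Qed.

(** First isomorphism theorem: the fibres of [pi] on A are the right cosets of A n ker, one for each
    element of the image S. *)
Lemma qorder_hom (A : gset F) (S : {set gT}) : is_subgroup A ->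
    (forall x, A x -> pi x \in S) -> (forall g, g \in S -> exists2 x, A x & pi x = g) ->
  qorder A (Defs.setI A (kernel pi)) #|S|.
Proof.
move=> sA AS SA.
have /choice[s sP] : forall k : 'I_#|S|, exists x, A x /\ pi x = enum_val k.
  by move=> k; have [x] := SA _ (enum_valP k); exists x.
have As k : A (s k) by case: (sP k).
have pis k : pi (s k) = enum_val k by case: (sP k).
exists s; split=> // a Aa; exists (enum_rank_in (AS a Aa) (pi a)); split=> [|k [_]].
  split; first exact: (subgroupF sA).
  by rewrite /kernel hom_pi homV pis enum_rankK_in ?AS // mulgV.
rewrite /kernel hom_pi homV pis => /divg1_eq E.
by apply: enum_val_inj; rewrite enum_rankK_in ?AS.
Qed.

Variable G : {group gT}.
Hypotheses (piG : forall x, pi x \in G) (Gpi : forall g, g \in G -> exists x, pi x = g).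

Lemma gamma_lcn i x : (0 < i)%N -> @gamma F i x -> pi x \in 'L_i(G).
Proof.
case: i => // i _; elim: i x => [|i IHi] x; first by rewrite lcn1.
rewrite gammaS // lcnSn => Gx.
apply: (commgrp_sub (preim_subgroup [group of [~: 'L_i.+1(G), G]]) _ Gx) => {Gx x} x y Gx _.
by rewrite homR mem_commg //; apply: IHi.
Qed.

(** The image of gamma_i(F) is a subgroup of [gT], so it is enough to lift the generating
    commutators of 'L_i(G). *)
Lemma lcn_gamma i g : (0 < i)%N -> g \in 'L_i(G) -> exists2 x, @gamma F i x & pi x = g.
Proof.
case: i => // i _; elim: i g => [|i IHi] g.
  by rewrite lcn1 => /Gpi[x <-]; exists x.
have sH := (gamma_normal F i.+2).1.
pose H := [set g | `[< exists2 x, @gamma F i.+2 x & pi x = g >]].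
have gH : group_set H.
  apply/group_setP; split=> [|g1 g2]; rewrite !inE.
    by apply/asboolP; exists 1; [apply: sH.1 | apply: hom1].
  move=> /asboolP[x Hx <-] /asboolP[y Hy <-]; apply/asboolP; exists (x * y) => //.
  exact: (subgroupM sH).
suff /subsetP sLH : 'L_i.+2(G) \subset Group gH by move=> /sLH; rewrite inE => /asboolP.
rewrite lcnSn gen_subG; apply/subsetP => _ /imset2P[a b La Gb ->]; rewrite inE.
have [x Hx <-] := IHi _ La; have [y <-] := Gpi Gb.
by apply/asboolP; exists [~ x, y]; [apply: mem_commgrp | apply: homR].
Qed.

(** For i = t this identifies the kernel of F -> G / gamma_t(G) as R gamma_t(F). *)
Lemma lcn_fiber i x : (0 < i)%N -> pi x \in 'L_i(G) <-> prodgrp (kernel pi) (@gamma F i) x.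
Proof.
move=> i_gt0; split=> [/(lcn_gamma i_gt0)[y Gy pi_y]|].
  rewrite -(mulgVK y x); apply: (subgroupM (gen_subgroup _)).
    by apply: prodgrp_l; rewrite /kernel hom_pi homV pi_y mulgV.
  exact: prodgrp_r.
apply: (prodgrp_sub (preim_subgroup [group of 'L_i(G)])) => y; last exact: gamma_lcn.
by move=> ->; apply: group1.
Qed.

End Homomorphisms.

(** * Comparison of the multipliers of G and of G / gamma_t(G) *)

Theorem theorem29 (gT : finGroupType) (G : {group gT}) (c t : nat)
    (F : groupType) (X : Type) (e : X -> F) (pi : F -> gT) :
  (1 <= c)%N -> (2 <= t)%N -> nilpotent G -> nil_class G = t ->
  free_on e -> is_hom pi -> (forall x, pi x \in G) ->
  (forall g, g \in G -> exists x, pi x = g) ->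
  let R := kernel pi in
  (* the induced free presentation of G / gamma_t(G) *)
  let Rb := kernel (fun x => coset 'L_t(G) (pi x)) in
  let Q := itcomm (prodgrp R (@gamma F t)) (@gall F) c in
  exists m mb q : nat,
    qorder (Mnum R c) (Mden R c) m /\
    qorder (Mnum Rb c) (Mden Rb c) mb /\
    qorder Q (Mden R c) q /\
    (* (i)(a) *)
    ((c + 1 <= t)%N -> (#|'L_t(G)| * m = mb * q)%N) /\
    (* (i)(b) *)
    ((t < c + 1)%N -> (#|'L_c.+1(G)| * m = mb * q)%N) /\
    (* (ii) *)
        (exists em emb eq : nat,
           [/\ qexponent (Mnum R c) (Mden R c) em,
               qexponent (Mnum Rb c) (Mden Rb c) emb,
               qexponent Q (Mden R c) eq &
               (em %| emb * eq)%N]) /\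
    (* (iii) *)
        (exists dm dmb dq : nat,
           [/\ qrank (Mnum R c) (Mden R c) dm,
               qrank (Mnum Rb c) (Mden Rb c) dmb,
               qrank Q (Mden R c) dq &
               (dm <= dmb + dq)%N]).
Proof.
move=> c_gt0 t_gt1 nilG clG _ hom_pi piG Gpi R Rb.
have t_gt0 : (0 < t)%N by apply: ltnW.
have Lt1 : 'L_t.+1(G) = 1 by apply/(lcn_nil_classP _ nilG); rewrite clG.
(* Since [coset] also sends everything outside the normaliser of 'L_t(G) to 1, [pi x] must be seen
   to normalise it. *)
have RbP x : Rb x <-> pi x \in 'L_t(G).
  have Nx : pi x \in 'N('L_t(G)) := subsetP (lcn_norm t G) _ (piG x).
  by split=> [/(coset_idr Nx) | /coset_id].
have -> : prodgrp R (@gamma F t) = Rb.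
  apply/predeqP => x; apply: iff_sym; apply: (iff_trans (RbP x)).
  exact: lcn_fiber.
move=> Q.
have nR : is_normal R by apply: kernel_normal.
have nRb : is_normal Rb.
  split=> [|x y /RbP Lx]; first split; first by apply/RbP; rewrite (hom1 hom_pi).
    by move=> x y /RbP Lx /RbP Ly; apply/RbP; apply: (subgroupF (preim_subgroup hom_pi _)).
  by apply/RbP; rewrite (homJ hom_pi) memJ_norm // (subsetP (lcn_norm t G)).
have sRRb x : R x -> Rb x by move=> Rx; apply/RbP; rewrite Rx.
have sG i : is_subgroup (@gamma F i) by apply: (gamma_normal _ _).1.
have sM : is_subgroup (Mnum R c) by apply: setI_subgroup => //; apply: nR.1.
have sMb : is_subgroup (Mnum Rb c) by apply: setI_subgroup => //; apply: nRb.1.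
have sQ : is_subgroup Q by apply: (itcomm_normal _ nRb).1.
have sD : is_subgroup (Mden R c) by apply: (itcomm_normal _ nR).1.
have sDQ x : Mden R c x -> Q x by apply: itcommS.
have sMMb x : Mnum R c x -> Mnum Rb c x by case=> /sRRb.
have sQM x : Q x -> Mnum R c x.
  move=> Qx; split; last by apply: itcommS Qx.
  (* Here c >= 1 puts Q inside [Rb,F], whose image in G lies in gamma_{t+1}(G) = 1. *)
  have {Qx} : itcomm Rb (@gall F) 1 x by apply: itcomm_antitone Qx.
  move: x; apply: commgrp_sub; first exact: nR.1.
  move=> x y /RbP Lx _; rewrite /R /kernel (homR hom_pi); apply/set1gP.
  by rewrite -Lt1; apply: (subsetP (lcnSnS t G)); apply: mem_commg.
have finD : fin_index (@gamma F c.+1) (Mden R c).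
  apply: (@fin_index_gamma _ _ #|G|) => //.
  - by move=> x; rewrite /R /kernel (homX hom_pi) expg_cardG.
  - exact: kernel_fin_index.
  - move=> x /(gamma_lcn hom_pi piG (ltn0Sn t)); rewrite Lt1 => /set1gP; exact.
have finM : fin_index (Mnum R c) (Mden R c) by apply: fin_indexS finD => // x [].
(* Q is also the denominator [Mden Rb c] of the second multiplier. *)
have finMb : fin_index (Mnum Rb c) Q by apply: fin_indexS finD => // x [].
have finQ : fin_index Q (Mden R c) by apply: fin_indexS finM.
have [m oM] := fin_index_qorder sD finM.
have [mb oMb] := fin_index_qorder sQ finMb.
have [q oQ] := fin_index_qorder sD finQ.
(* The index of [Mden R c] in [Mnum Rb c] is computed through [Mnum R c] and through Q. *)
have Lagrange k : qorder (Mnum Rb c) (Mnum R c) k -> (k * m = mb * q)%N.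
  move=> ok; apply: (qorder_uniq sD (A := Mnum Rb c)).
    by apply: qorderM ok oM => // x /sDQ/sQM.
  by apply: qorderM oMb oQ => // x /sQM/sMMb.
have MnumE : Mnum R c = Defs.setI (Mnum Rb c) R.
  by apply/predeqP => x; split=> [Mx|[[_ Gx] Rx]//]; split; [apply: sMMb | case: Mx].
have expM a : Mnum R c a -> Mden R c (a ^+ m`!) by apply: qorder_exp oM a.
have expMb a : Mnum Rb c a -> Q (a ^+ mb`!) by apply: qorder_exp oMb a.
have expQ a : Q a -> Mden R c (a ^+ q`!) by apply: qorder_exp oQ a.
exists m, mb, q; do 3!split=> //; split; last split; last split.
(* If c + 1 <= t then gamma_t(F) <= gamma_{c+1}(F), so [pi] maps [Mnum Rb c] onto gamma_t(G). *)
- move=> le_ct; apply: Lagrange; rewrite MnumE; apply: qorder_hom => // [x [/RbP]//|g Lg].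
  have [x Gx <-] := lcn_gamma hom_pi Gpi t_gt0 Lg; exists x => //; split.
    by apply/RbP; apply: gamma_lcn Gx.
  by apply: gamma_antitone Gx; rewrite -addn1.
(* If t < c + 1 then gamma_{c+1}(F) <= Rb, so the image is gamma_{c+1}(G). *)
- move=> lt_tc; rewrite addn1 in lt_tc; apply: Lagrange; rewrite MnumE.
  apply: qorder_hom => // [x [_]|g Lg]; first exact: gamma_lcn.
  have [x Gx <-] := lcn_gamma hom_pi Gpi (ltn0Sn c) Lg; exists x => //; split=> //.
  by apply/RbP; apply: (gamma_lcn hom_pi piG) => //; apply: gamma_antitone Gx; apply: ltnW.
- have [|em eM] := @qexponent_exists _ (Mnum R c) (Mden R c).
    by exists m`!; [apply: fact_gt0 | ].
  have [|emb eMb] := @qexponent_exists _ (Mnum Rb c) Q.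
    by exists mb`!; [apply: fact_gt0 | ].
  have [|eq eQ] := @qexponent_exists _ Q (Mden R c).
    by exists q`!; [apply: fact_gt0 | ].
  exists em, emb, eq; split=> //; apply: (qexponent_dvd sD eM) => a /sMMb Ma.
  by rewrite expgnA; apply: eQ.1.2; apply: eMb.1.2.
have sDM x : Mden R c x -> Mnum R c x by move=> /sDQ/sQM.
have sQMb x : Q x -> Mnum Rb c x by move=> /sQM/sMMb.
have [dm rM] := qrank_exists sM sD sDM finM.
have [dmb rMb] := qrank_exists sMb sQ sQMb finMb.
have [dq rQ] := qrank_exists sQ sD sDQ finQ.
exists dm, dmb, dq; split=> //; apply: rM.2.
apply: qgenerated_by_trans rQ.1 => //.
(* [Mnum R c] / Q is a subgroup of [Mnum Rb c] / Q, which is abelian by [Rb, gamma_{c+1}(F)] <=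
   [Rb,_{c+1} F] <= Q; hence dmb generators suffice. *)
apply: (qgenerated_by_subgroup sMb sQ sM sQM sMMb _ (fact_gt0 mb) expMb rMb.1).
move=> x y [Rbx _] [_ Gy]; apply: (itcomm_antitone nRb (leqnSn c)).
exact: commg_gamma.
Qed.
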